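(* Let $p$ be an odd prime and $n$ a positive integer. (1) For $G=ES_1(p,n)$, $$|End(G)|=p^{n^2+2n}(p-1)\prod_{j=1}^{n}(p^{2j}-1)+p^{2n}\sum_{k=0}^{n}\alpha_k(p,n)\gamma_k(p,n).$$ (2) For $G=ES_2(p,n)$, $$|End(G)|=p^{n^2+2n}(p-1)\prod_{j=1}^{n-1}(p^{2j}-1)+p^{2n}\sum_{k=0}^{n}\beta_k(p,n)\gamma_k(p,n).$$
   Context: $End(G)$ is the semigroup of group endomorphisms of $G$. $ES_1(p,n)$ is the set $\mathbb{F}_p^n\oplus\mathbb{F}_p^n\oplus\mathbb{F}_p$ with group operation $(\underline{u}^1,\underline{w}^1,z^1).(\underline{u}^2,\underline{w}^2,z^2)=(\underline{u}^1+\underline{u}^2,\underline{w}^1+\underline{w}^2,z^1+z^2+\langle\underline{u}^1,\underline{w}^2\rangle)$, where $\langle\underline{u},\underline{w}\rangle=\sum_{i=1}^nu_iw_i$. $ES_2(p,n)$ is the set $\mathbb{Z}/p^2\mathbb{Z}\oplus(\mathbb{Z}/p\mathbb{Z})^{n-1}\oplus\mathbb{Z}/p\mathbb{Z}\oplus(\mathbb{Z}/p\mathbb{Z})^{n-1}$ with group operation $(u^1_1,\underline{u}^1,w^1_1,\underline{w}^1).(u^2_1,\underline{u}^2,w^2_1,\underline{w}^2)=\big(u^1_1+u^2_1+i_{21}(w^2_1)u^1_1+i_{21}(\langle\underline{u}^1,\underline{w}^2\rangle),\underline{u}^1+\underline{u}^2,w^1_1+w^2_1,\underline{w}^1+\underline{w}^2\big)$,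 where $i_{21}:\mathbb{Z}/p\mathbb{Z}\hookrightarrow\mathbb{Z}/p^2\mathbb{Z}$, $a\mapsto pa$, and $\langle\underline{u},\underline{w}\rangle=\sum_{i=2}^nu_iw_i\in\mathbb{Z}/p\mathbb{Z}$ for $\underline{u}=(u_2,\ldots,u_n)^t$, $\underline{w}=(w_2,\ldots,w_n)^t$. On $\mathbb{F}_p^{2n}$ take the symplectic form $\langle\langle v,w\rangle\rangle=\sum_{i=1}^n(v_iw_{n+i}-v_{n+i}w_i)$; a subspace $W$ is isotropic if the form vanishes on $W\times W$. Let $e_1,\ldots,e_n,f_1,\ldots,f_n$ be the standard basis of $\mathbb{F}_p^{2n}$ (in this order) and $V_1=\langle e_2,\ldots,e_n,f_1,\ldots,f_n\rangle$. For $0\le k\le n$: $\alpha_k(p,n)$ is the number of $k$-dimensional isotropic subspaces of $\mathbb{F}_p^{2n}$; $\beta_k(p,n)$ is the number of $k$-dimensional isotropic subspaces contained in $V_1$; $\gamma_k(p,n)$ is the number of surjective linear maps $\mathbb{F}_p^{2n}\to\mathbb{F}_p^k$. Explicitly, with $\binom{m}{k}_p$ the Gaussian binomial coefficient: $\alpha_0=1$ and $\alpha_k=\binom{n}{k}_p\prod_{i=0}^{k-1}(p^{n-i}+1)$ for $1\le k\le n$; $\beta_0=1$, $\beta_1=\binom{2n-1}{1}_p$ and $\beta_k=\big(p^k(p^{n-k}+1)\binom{n-1}{k}_p+\binom{n-1}{k-1}_p\big)\prod_{i=1}^{k-1}(p^{n-i}+1)$ for $2\le k\le n$; $\gamma_0=1$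 and $\gamma_k=p^{2nk}-\sum_{i=0}^{k-1}\binom{k}{i}_p\gamma_i$ for $1\le k\le n$. *)

(* Defs.v *)
From HB Require Import structures.
From mathcomp Require Import all_boot all_order all_algebra all_fingroup.
From mathcomp Require Import ring.

Set Implicit Arguments.
Unset Strict Implicit.
Unset Printing Implicit Defensive.

Import GRing.Theory VectorInternalTheory.
Local Open Scope ring_scope.

(* Over a finite field, subspaces and linear maps form finite types, so that *)
(* they can be counted with #|_|.                                            *)
HB.instance Definition _ (F : finFieldType) (vT : vectType F) :=
  [Finite of {vspace vT} by <:].
HB.instance Definition _ (F : finFieldType) (aT rT : vectType F) :=
  [Finite of 'Hom(aT, rT) by <:].

(* Preserving products is enough for a group morphism: units and inverses     *)
(* follow.                                                                    *)
Definition Endg (gT : finGroupType) : {set {ffun gT -> gT}} :=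
  [set f : {ffun gT -> gT} |
    [forall x, forall y, f (x * y)%g == (f x * f y)%g]].

Definition dot (R : pzRingType) (m : nat) (u w : 'rV[R]_m) : R :=
  \sum_(i < m) u 0 i * w 0 i.

Lemma dotDl (R : pzRingType) m (u v w : 'rV[R]_m) :
  dot (u + v) w = dot u w + dot v w.
Proof. by rewrite -big_split; apply: eq_bigr => i _; rewrite mxE mulrDl. Qed.

Lemma dotDr (R : pzRingType) m (u v w : 'rV[R]_m) :
  dot u (v + w) = dot u v + dot u w.
Proof. by rewrite -big_split; apply: eq_bigr => i _; rewrite mxE mulrDr. Qed.

Lemma dotNl (R : pzRingType) m (u w : 'rV[R]_m) : dot (- u) w = - dot u w.
Proof. by rewrite -sumrN; apply: eq_bigr => i _; rewrite mxE mulNr. Qed.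

Lemma dot0l (R : pzRingType) m (w : 'rV[R]_m) : dot 0 w = 0.
Proof. by apply: big1 => i _; rewrite mxE mul0r. Qed.

Section ES1.
Variables p n : nat.

Definition ES1 : predArgType := ('rV['F_p]_n * 'rV['F_p]_n * 'F_p)%type.

Definition ES1_mul (x y : ES1) : ES1 :=
  let: (u1, w1, z1) := x in
  let: (u2, w2, z2) := y in
  (u1 + u2, w1 + w2, z1 + z2 + dot u1 w2).

Definition ES1_one : ES1 := (0, 0, 0).

Definition ES1_inv (x : ES1) : ES1 :=
  let: (u, w, z) := x in (- u, - w, - z + dot u w).

Lemma ES1_mulA : associative ES1_mul.
Proof.
move=> [[u1 w1] z1] [[u2 w2] z2] [[u3 w3] z3] /=; congr (_, _, _).
- exact: addrA.
- exact: addrA.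
by rewrite dotDl dotDr; ring.
Qed.

Lemma ES1_mul1 : left_id ES1_one ES1_mul.
Proof. by move=> [[u w] z] /=; rewrite dot0l !add0r addr0. Qed.

Lemma ES1_mulV : left_inverse ES1_one ES1_inv ES1_mul.
Proof.
move=> [[u w] z] /=; rewrite dotNl !addNr; congr (_, _, _).
ring.
Qed.

HB.instance Definition _ := Finite.on ES1.
HB.instance Definition _ :=
  Finite_isGroup.Build ES1 ES1_mulA ES1_mul1 ES1_mulV.

End ES1.

Definition i21 (p : nat) (a : 'F_p) : 'Z_(p ^ 2) := (p * a)%N%:R.

Section I21.
Variables (p : nat) (p_pr : prime p).

Let p2_gt1 : (1 < p ^ 2)%N.
Proof. by rewrite (ltn_exp2l 0) ?prime_gt1. Qed.

Lemma i21D (a b : 'F_p) : i21 (a + b) = i21 a + i21 b.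
Proof.
have -> : i21 (a + b) = (p * ((a + b) %% p))%N%:R.
  by rewrite /i21 -[in RHS](congr1 (modn (a + b)%N) (Fp_cast p_pr)).
rewrite /i21 -natrD -mulnDr -[LHS](Zp_nat_mod p2_gt1).
by rewrite -[RHS](Zp_nat_mod p2_gt1) muln_modr mulnn modn_mod.
Qed.

Lemma i21_0 : i21 (0 : 'F_p) = 0.
Proof. by rewrite /i21 muln0. Qed.

Lemma i21N (a : 'F_p) : i21 (- a) = - i21 a.
Proof. by apply/eqP; rewrite -addr_eq0 -i21D addNr i21_0. Qed.

Lemma i21M0 (a b : 'F_p) : i21 a * i21 b = 0.
Proof.
rewrite /i21 -natrM mulnACA mulnn natrM -(Zp_nat_mod p2_gt1) modnn.
by rewrite mul0r.
Qed.

End I21.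

Section ES2.
Variables (p n : nat) (p_pr : prime p).

(* The group law below is associative only because [i21] is additive, which  *)
(* is why the type carries the proof that [p] is prime. The row of index     *)
(* [i < n.-1] is the paper's coordinate [i + 2].                             *)
Definition ES2 of prime p : predArgType :=
  ('Z_(p ^ 2) * 'rV['F_p]_n.-1 * 'F_p * 'rV['F_p]_n.-1)%type.

Local Notation T := (ES2 p_pr).

Definition ES2_mul (x y : T) : T :=
  let: (a1, u1, b1, w1) := x in
  let: (a2, u2, b2, w2) := y in
  (a1 + a2 + i21 b2 * a1 + i21 (dot u1 w2), u1 + u2, b1 + b2, w1 + w2).

Definition ES2_one : T := (0, 0, 0, 0).

Definition ES2_inv (x : T) : T :=
  let: (a, u, b, w) := x in
  (- a + i21 b * a + i21 (dot u w), - u, - b, - w).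

Lemma ES2_mulA : associative ES2_mul.
Proof.
move=> [[[a1 u1] b1] w1] [[[a2 u2] b2] w2] [[[a3 u3] b3] w3] /=.
congr (_, _, _, _); rewrite ?addrA // dotDl dotDr !(i21D p_pr) !mulrDr !mulrDl.
rewrite [i21 b3 * (i21 b2 * _)]mulrA !(i21M0 p_pr) mul0r !addr0.
ring.
Qed.

Lemma ES2_mul1 : left_id ES2_one ES2_mul.
Proof.
by move=> [[[a u] b] w] /=; rewrite dot0l i21_0 mulr0 !add0r !addr0.
Qed.

Lemma ES2_mulV : left_inverse ES2_one ES2_inv ES2_mul.
Proof.
move=> [[[a u] b] w] /=; rewrite dotNl (i21N p_pr) !addNr.
congr (_, _, _, _).
rewrite !mulrDr mulrN mulrA !(i21M0 p_pr) mul0r !addr0.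
ring.
Qed.

HB.instance Definition _ := Finite.on T.
HB.instance Definition _ := Finite_isGroup.Build T ES2_mulA ES2_mul1 ES2_mulV.

End ES2.

Section Symplectic.
Variables (p n : nat).

Local Notation V := 'rV['F_p]_(n + n).

(* The indices [lshift n i] and [rshift n i] are the paper's [i] and [n + i]. *)
Definition symp (v w : V) : 'F_p :=
  \sum_(i < n) (v 0 (lshift n i) * w 0 (rshift n i)
                - v 0 (rshift n i) * w 0 (lshift n i)).

Definition isotropic (W : {vspace V}) : bool :=
  [forall v, forall w, (v \in W) ==> (w \in W) ==> (symp v w == 0)].

(* Spanned by all standard basis vectors except [e_1], of index [0]. *)
Definition V1 : {vspace V} :=
  (\sum_(j < n + n | (0 < j)%N) <[delta_mx 0%R j : V]>)%VS.

Definition alpha (k : nat) : nat :=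
  #|[set W : {vspace V} | (\dim W == k) && isotropic W]|.

Definition beta (k : nat) : nat :=
  #|[set W : {vspace V} | [&& \dim W == k, isotropic W & (W <= V1)%VS]]|.

Definition gamma (k : nat) : nat :=
  #|[set f : 'Hom(V, 'rV['F_p]_k) | limg f == fullv]|.

End Symplectic.

(* Main.v *)
(* Both groups are central extensions of V = F_p^2n by F_p in which the       *)
(* commutator is the symplectic form and the p-th power is a linear form l (l *)
(* = 0 for ES1, the first coordinate for ES2). An endomorphism induces a pair *)
(* (A, lam), linear on V and scalar on the centre, such that A rescales both  *)
(* the symplectic form and l by lam. Conversely, as p is odd, every such pair *)
(* lifts, and its lifts form a torsor under the dual of V, whence the factor  *)
(* p^2n. For lam = 0 the condition on A is that its image is isotropic and    *)
(* lies in the kernel of l; sorting by the image gives the sum over k. For    *)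
(* lam != 0, A amounts to a basis of hyperbolic pairs of value lam, chosen    *)
(* one pair after the other in the orthogonal of the previous ones. When l is *)
(* the first coordinate, that is l v = <<v, f_1>>, the second condition says  *)
(* that A fixes f_1, so that the first pair is (e, f_1) with e free in an     *)
(* affine hyperplane.                                                         *)

From HB Require Import structures.
Require Import Defs.
From mathcomp Require Import all_boot all_order all_algebra all_fingroup.
From mathcomp Require Import ring zify.

Set Implicit Arguments.
Unset Strict Implicit.
Unset Printing Implicit Defensive.

Import GRing.Theory.
Local Open Scope ring_scope.

(** The section [Extension] isolates what the two groups share: a projection [pi] onto V, a
    set-theoretic section [s], a central copy [iota] of F_p, and formulas for commutators and p-th
    powers. There [card_Endg] reduces the theorem to counting pairs (A, lam): [Endg_lifts] reads the
    pair off commutators and p-th powers, and [card_lifts] counts the endomorphisms above a given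
    pair. That each pair lifts is a cocycle argument: the antisymmetrised cocycle is the symplectic
    form, so pulling the cocycle back along A and subtracting lam times it leaves a symmetric
    bilinear form, which is a coboundary because 2 is invertible ([cocycle_coboundary]).

    [card_simil] separates lam = 0 from the p - 1 nonzero values, which all contribute equally. For
    lam != 0 the rows of A form a hyperbolic system, counted by [card_hypset] and brought to closed
    form by [symplectic_order]; in ES2 the row f_1 is forced, its partner has p^(2n-1) choices, and
    a system of rank n - 1 remains. For lam = 0, A is sorted by its image ([card_limg_pred]): each
    admissible image of dimension k accounts for gamma_k maps. *)

Lemma card_pair_fiber (A B : finType) (P : pred A) (Q : A -> B -> bool) k :
  (forall a, P a -> #|[set b | Q a b]| = k) ->
  #|[set x : A * B | P x.1 && Q x.1 x.2]| = (#|[set a | P a]| * k)%N.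
Proof.
move=> PQ; transitivity (\sum_(a | P a) \sum_(b | Q a b) 1)%N.
  by rewrite pair_big_dep sum1dep_card.
rewrite cardsE -sum_nat_const; apply: eq_bigr => a /PQ <-.
by rewrite sum1dep_card.
Qed.

(** * Counting systems of hyperbolic pairs *)

Section Hyperbolic.
Variable F : finFieldType.

(** Full column rank makes [y *m B] surjective, and all its fibres are translates of the kernel, so
    they share the |F|^N vectors equally. *)
Lemma card_mulmx_fiber N m (B : 'M[F]_(N, m)) (c : 'rV_m) : row_full B ->
  #|[set y : 'rV_N | y *m B == c]| = (#|F| ^ (N - m))%N.
Proof.
move=> fullB; have leqmN : (m <= N)%N by rewrite -(eqP fullB) rank_leq_row.
have fib0 d : #|[set y : 'rV_N | y *m B == d]| = #|[set y : 'rV_N | y *m B == 0]|.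
  rewrite -(card_imset _ (addrI (- d *m pinvmx B))).
  apply: eq_card => y; rewrite inE; apply/imsetP/eqP.
    by case=> x; rewrite inE => /eqP xB ->;
      rewrite mulmxDl -mulmxA mulVpmx // mulmx1 xB addNr.
  move=> yB; exists (d *m pinvmx B + y); last by rewrite mulNmx addKr.
  by rewrite inE mulmxDl -mulmxA mulVpmx // mulmx1 yB addr0.
have : (#|F| ^ N = #|F| ^ m * #|[set y : 'rV_N | y *m B == 0%R]|)%N.
  transitivity #|[set: 'rV[F]_N]|; first by rewrite cardsT card_mx mul1n.
  rewrite -sum1_card (partition_big (fun y => y *m B) predT) //=.
  rewrite (eq_bigr (fun=> #|[set y : 'rV_N | y *m B == 0%R]|)).
    by rewrite sum_nat_const card_mx mul1n.
  move=> d _; rewrite -(fib0 d) -sum1_card; apply: eq_bigl => y.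
  by rewrite !inE.
rewrite fib0 -{1}(subnKC leqmN) expnD => /eqP.
have q0 : (0 < #|F|)%N by apply/card_gt0P; exists 0.
by rewrite eqn_pmul2l ?expn_gt0 ?q0 // => /eqP.
Qed.

Variables (N : nat) (J : 'M[F]_N).
Hypotheses (uJ : J \in unitmx) (skewJ : J^T = - J)
  (altJ : forall v : 'rV_N, v *m J *m v^T = 0).

Definition orth m1 m2 (S : 'M_(m1, N)) (T : 'M_(m2, N)) : bool :=
  S *m J *m T^T == 0.

Lemma form_tr m1 m2 (S : 'M_(m1, N)) (T : 'M_(m2, N)) :
  T *m J *m S^T = - (S *m J *m T^T)^T.
Proof. by rewrite !trmx_mul trmxK skewJ mulNmx mulmxN opprK mulmxA. Qed.

Lemma orthC m1 m2 (S : 'M_(m1, N)) (T : 'M_(m2, N)) : orth S T = orth T S.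
Proof.
by rewrite /orth [in RHS]form_tr oppr_eq0 -[in RHS]trmx0 (inj_eq trmx_inj).
Qed.

Lemma orth_col m1 m2 m3 (S : 'M_(m1, N)) (T : 'M_(m2, N)) (U : 'M_(m3, N)) :
  orth U (col_mx S T) = orth U S && orth U T.
Proof.
rewrite /orth tr_col_mx mul_mx_row -row_mx0.
by apply/eqP/andP => [/eq_row_mx[-> ->]//|[/eqP-> /eqP->]].
Qed.

(* [E] and [K] list the first and the second members of [j] hyperbolic pairs. *)
Definition hyperbolic lam j (E K : 'M_(j, N)) : bool :=
  [&& orth E E, orth K K & E *m J *m K^T == lam%:M].

Definition hypset lam m (S : 'M_(m, N)) j : {set 'M[F]_(j, N) * 'M[F]_(j, N)} :=
  [set x | [&& orth S x.1, orth S x.2 & hyperbolic lam x.1 x.2]].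

(** Makes orthogonality to independent rows a system of independent equations, to which
    [card_mulmx_fiber] applies. *)
Lemma row_full_form m (S : 'M_(m, N)) : row_free S -> row_full (J *m S^T).
Proof.
move=> freeS; rewrite /row_full (eqmxMfull _ (_ : row_full J)).
  by rewrite mxrank_tr.
by rewrite row_full_unit.
Qed.

Lemma nondeg_free m (S : 'M_(m, N)) : S *m J *m S^T \in unitmx -> row_free S.
Proof.
move=> uS; apply/row_freeP; exists (J *m S^T *m invmx (S *m J *m S^T)).
by rewrite !mulmxA mulmxV.
Qed.

(** The first member is any nonzero vector orthogonal to S; the second then solves m + 1 independent
    equations, one of them inhomogeneous. *)
Lemma card_hyp_pair lam m (S : 'M_(m, N)) : lam != 0 ->
  S *m J *m S^T \in unitmx ->
  #|[set x : 'rV_N * 'rV_N |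
      [&& orth S x.1, orth S x.2 & x.1 *m J *m x.2^T == lam%:M]]|
  = ((#|F| ^ (N - m) - 1) * #|F| ^ (N - m - 1))%N.
Proof.
move=> lam0 uS; have freeS := nondeg_free uS.
(* Since lam != 0, the first member cannot vanish; stating this separately makes all fibres over it
   equal in size. *)
transitivity #|[set x : 'rV_N * 'rV_N | (orth S x.1 && (x.1 != 0)) &&
     (orth S x.2 && (x.1 *m J *m x.2^T == lam%:M))]|.
  apply: eq_card => [[e k]]; rewrite !inE /=.
  case: (orth S e) => //=; case: (e =P 0) => [->|//]; rewrite !mul0mx /=.
  apply/negbTE; rewrite negb_and; apply/orP; right; apply: contra lam0.
  by move/eqP/matrixP/(_ 0 0); rewrite !mxE eqxx mulr1n => <-.
rewrite (card_pair_fiber (P := fun e => orth S e && (e != 0))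
  (Q := fun e k => orth S k && (e *m J *m k^T == lam%:M))
  (k := (#|F| ^ (N - m - 1))%N)).
  congr (_ * _)%N; rewrite -(card_mulmx_fiber 0 (row_full_form freeS)).
  have z0 : 0 \in [set y : 'rV_N | y *m (J *m S^T) == 0] by rewrite inE mul0mx.
  rewrite [in RHS](cardsD1 0) z0 addKn.
  by apply: eq_card => e; rewrite !inE andbC orthC /orth mulmxA.
move=> e /andP[Se e0].
(* Pairing a linear relation with S kills the e-term, and the invertible Gram matrix of S then kills
   the coefficients on S. *)
have freeSe : row_free (col_mx S e).
  apply/inj_row_free => v; rewrite -[v]hsubmxK mul_row_col => v0.
  have: (lsubmx v *m S + rsubmx v *m e) *m (J *m S^T) = 0 by rewrite v0 mul0mx.
  move: Se; rewrite orthC /orth => /eqP Se.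
  rewrite mulmxDl -!mulmxA [e *m _]mulmxA Se mulmx0 addr0 [S *m _]mulmxA.
  move/(congr1 (mulmx^~ (invmx (S *m J *m S^T))));
    rewrite mul0mx mulmxK // => l0.
  move: v0; rewrite l0 mul0mx add0r [rsubmx v]mx11_scalar mul_scalar_mx.
  move/eqP; rewrite scaler_eq0 (negPf e0) orbF => /eqP ->.
  by rewrite raddf0 row_mx0.
rewrite -subnDA -(card_mulmx_fiber (row_mx 0 (- lam%:M)) (row_full_form freeSe)).
apply: eq_card => k; rewrite !inE mulmxA tr_col_mx mul_mx_row.
rewrite orthC /orth.
have -> : (e *m J *m k^T == lam%:M) = (k *m J *m e^T == - lam%:M).
  rewrite [in RHS]form_tr (inj_eq (@oppr_inj _)) -[in RHS]tr_scalar_mx.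
  by rewrite (inj_eq trmx_inj).
apply/andP/eqP => [[/eqP-> /eqP->]//|/eq_row_mx[-> ->]//].
Qed.

Lemma col_orth m1 m2 m3 (S : 'M_(m1, N)) (T : 'M_(m2, N)) (U : 'M_(m3, N)) :
  orth (col_mx S T) U = orth S U && orth T U.
Proof. by rewrite orthC orth_col ![orth U _]orthC. Qed.

Lemma hyperbolic_col lam j (e f : 'rV_N) (E K : 'M_(j, N)) :
  hyperbolic lam (col_mx e E) (col_mx f K) =
  [&& e *m J *m f^T == lam%:M, orth e E, orth e K, orth f E, orth f K
    & hyperbolic lam E K].
Proof.
have alt (v : 'rV_N) : orth v v by apply/eqP; exact: altJ.
rewrite /hyperbolic.
have -> : (col_mx e E *m J *m (col_mx f K)^T == lam%:M) =
    [&& e *m J *m f^T == lam%:M, orth e K, orth E f & E *m J *m K^T == lam%:M].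
  rewrite tr_col_mx mul_col_mx mul_col_row scalar_mx_block /orth.
  by apply/eqP/and4P => [/eq_block_mx[-> -> -> ->]//|[/eqP-> /eqP-> /eqP-> /eqP->]].
rewrite !orth_col !col_orth !alt.
rewrite [orth E e]orthC [orth K f]orthC [orth E f]orthC.
by case: (orth e E); case: (orth f K); case: (orth e K); case: (orth f E);
   rewrite ?andbF ?andbT //=; case: (orth E E); case: (orth K K);
     rewrite ?andbF //= ?andbT.
Qed.

Lemma unitmx_hyp_pair lam (e f : 'rV_N) : lam != 0 -> e *m J *m f^T = lam%:M ->
  col_mx e f *m J *m (col_mx e f)^T \in unitmx.
Proof.
move=> lam0 ef; rewrite tr_col_mx mul_col_mx mul_col_row !altJ.
rewrite [f *m J *m _]form_tr ef tr_scalar_mx.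
suff /mulmx1_unit[] : block_mx 0 lam%:M (- lam%:M) 0 *m
    block_mx 0 (- lam^-1%:M) lam^-1%:M 0 = 1%:M :> 'M_(1 + 1) by [].
rewrite mulmx_block !mul0mx !mulmx0 mulmxN mulNmx opprK -!scalar_mxM mulfV //.
by rewrite !add0r !addr0 -scalar_mx_block.
Qed.

(** Induction on j with S general: the first pair joins S, whose Gram matrix stays invertible
    because it becomes block diagonal, and m grows by 2. *)
Lemma card_hypset lam m (S : 'M_(m, N)) j : lam != 0 ->
  S *m J *m S^T \in unitmx ->
  #|hypset lam S j| = (\prod_(i < j)
     ((#|F| ^ (N - m - 2 * i) - 1) * #|F| ^ (N - m - 2 * i - 1)))%N.
Proof.
move=> lam0; elim: j m S => [|j IHj] m S uS.
  rewrite big_ord0; apply/eqP/cards1P; exists (0, 0); apply/setP => -[E K].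
  rewrite !inE [E]flatmx0 [K]flatmx0 eqxx /hyperbolic /orth trmx0 !mulmx0 eqxx.
  by rewrite [_%:M]flatmx0 eqxx.
rewrite big_ord_recl muln0 subn0.
transitivity #|hypset lam S (1 + j)|; first by [].
pose g (x : ('rV_N * 'rV_N) * ('M_(j, N) * 'M_(j, N))) :
    'M[F]_(1 + j, N) * 'M[F]_(1 + j, N) :=
  (col_mx x.1.1 x.2.1, col_mx x.1.2 x.2.2).
have bij_g : bijective g.
  exists (fun y => ((usubmx y.1, usubmx y.2), (dsubmx y.1, dsubmx y.2))).
    by case=> [[e f] [E K]]; rewrite /g /= !col_mxKu !col_mxKd.
  by case=> E K; rewrite /g /= !vsubmxK.
rewrite -(on_card_preimset (onW_bij _ bij_g)).
rewrite -(card_hyp_pair lam0 uS).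
set P := fun x : 'rV_N * 'rV_N => _.
pose Q (x : 'rV_N * 'rV_N) y := y \in hypset lam (col_mx S (col_mx x.1 x.2)) j.
have -> : g @^-1: hypset lam S (1 + j) = [set x | P x.1 && Q x.1 x.2].
  apply/setP => [[[e f] [E K]]];
    rewrite /Q /P /g /hypset !inE /= hyperbolic_col !orth_col !col_orth.
  by case: (orth S e); case: (orth S f); case: (orth S E); case: (orth S K);
     case: (orth e E); case: (orth e K); case: (orth f E); case: (orth f K);
     rewrite /= ?andbF ?andbT.
apply: card_pair_fiber => -[e f] /and3P[/= Se Sf ef].
rewrite cardsE IHj.
  by apply: eq_bigr => i _; rewrite /= /bump leq0n;
    congr ((_ ^ _ - _) * _ ^ _)%N; lia.
have -> : col_mx S (col_mx e f) *m J *m (col_mx S (col_mx e f))^T =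
    block_mx (S *m J *m S^T) 0 0 (col_mx e f *m J *m (col_mx e f)^T).
  have Sef : S *m J *m (col_mx e f)^T = 0 by apply/eqP;
    rewrite -/(orth _ _) orth_col Se.
  rewrite [(col_mx S _)^T]tr_col_mx mul_col_mx mul_col_row Sef.
  by rewrite [col_mx e f *m J *m S^T]form_tr Sef trmx0 oppr0.
rewrite unitmxE det_ublock unitrM -!unitmxE uS /=.
exact: (unitmx_hyp_pair lam0 (eqP ef)).
Qed.

End Hyperbolic.

(** * Similitudes with nonzero multiplier *)

Section Similitudes.
Variable F : finFieldType.

Definition Jmx n : 'M[F]_(n + n) := block_mx 0 1%:M (- 1%:M) 0.

Lemma Jmx_tr n : (Jmx n)^T = - Jmx n.
Proof.
by rewrite tr_block_mx opp_block_mx !raddfN /= !trmx1 !trmx0 opprK !oppr0.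
Qed.

Lemma Jmx_unit n : Jmx n \in unitmx.
Proof.
suff /mulmx1_unit[] : Jmx n *m - Jmx n = 1%:M by [].
rewrite opp_block_mx oppr0 opprK mulmx_block !mulmx0 !mul0mx !mul1mx.
by rewrite mulmxN mulNmx mulmx1 opprK !addr0 !add0r -scalar_mx_block.
Qed.

Lemma row_Jmx n (a b c d : 'rV_n) :
  row_mx a b *m Jmx n *m (row_mx c d)^T = a *m d^T - b *m c^T.
Proof.
rewrite /Jmx mul_row_block !mulmx0 mulmxN !mulmx1 add0r addr0 tr_row_mx.
by rewrite mul_row_col mulNmx addrC.
Qed.

Lemma Jmx_alt n (v : 'rV_(n + n)) : v *m Jmx n *m v^T = 0.
Proof.
rewrite -[v]hsubmxK row_Jmx; apply/eqP; rewrite subr_eq0; apply/eqP.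
apply/matrixP => i j; rewrite !ord1 !mxE.
by apply: eq_bigr => k _; rewrite !mxE mulrC.
Qed.

(* [(A, lam)] is a similitude of the symplectic form, acting on row vectors,  *)
(* that also rescales the linear form [v |-> v *m l] by [lam].                *)
Definition simil n (l : 'cV_(n + n)) (A : 'M[F]_(n + n)) lam : bool :=
  (A *m Jmx n *m A^T == lam *: Jmx n) && (A *m l == lam *: l).

(** The upper and lower halves of A are the images of the e_i and of the f_i, so A is a hyperbolic
    system with nothing prescribed: S is the empty matrix. *)
Lemma card_simil0 n lam : lam != 0 ->
  #|[set A | simil (0 : 'cV_(n + n)) A lam]| =
  (\prod_(i < n) ((#|F| ^ (n + n - 2 * i) - 1) * #|F| ^ (n + n - 2 * i - 1)))%N.
Proof.
move=> lam0; pose S : 'M[F]_(0, n + n) := 0.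
have uS : S *m Jmx n *m S^T \in unitmx by rewrite unitmxE det_mx00 unitr1.
have := card_hypset (@Jmx_unit n) (@Jmx_tr n) (@Jmx_alt n) n lam0 uS.
rewrite subn0 => <-.
pose g (x : 'M[F]_(n, n + n) * 'M[F]_(n, n + n)) := col_mx x.1 x.2.
have bij_g : bijective g.
  exists (fun A => (usubmx A, dsubmx A)); last by move=> A; rewrite /g vsubmxK.
  by case=> E K; rewrite /g col_mxKu col_mxKd.
rewrite -(on_card_preimset (onW_bij _ bij_g)).
apply: eq_card => -[E K];
  rewrite /hypset !inE /g /simil /= mulmx0 scaler0 eqxx andbT.
rewrite /S /orth !mul0mx eqxx /=.
rewrite /hyperbolic /orth.
rewrite scale_block_mx !scaler0 scalerN scalemx1 tr_col_mx mul_col_mx mul_col_row.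
apply/eqP/and3P => [/eq_block_mx[-> -> _ ->]|[/eqP-> /eqP-> /eqP EK]];
  first by rewrite !eqxx.
rewrite EK (@form_tr _ _ _ (Jmx_tr n)) EK tr_scalar_mx //.
Qed.

(** The basis vector f_1 in rank 1 + n; [Jmx (1 + n) *m (f1 n)^T] is then the first-coordinate form
    ([mul_Jmx_f1]). *)
Definition f1 n : 'rV[F]_((1 + n) + (1 + n)) := row_mx 0 (row_mx 1%:M 0).

(** Replace lam J by A J A^T in A l = lam l, where l = J f_1^T, and cancel A J, which is invertible
    because lam != 0. *)
Lemma simil_f1 n A lam : lam != 0 ->
  simil (Jmx (1 + n) *m (f1 n)^T) A lam =
  (A *m Jmx (1 + n) *m A^T == lam *: Jmx (1 + n)) && (f1 n *m A == f1 n).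
Proof.
move=> lam0; rewrite /simil; case: eqP => //= AJA.
have uAJ : A *m Jmx (1 + n) \in unitmx.
  suff /mulmx1_unit[] : (A *m Jmx (1 + n)) *m
      (A^T *m invmx (lam *: Jmx (1 + n))) = 1%:M by [].
  by rewrite mulmxA AJA mulmxV // unitmxZ ?unitfE // Jmx_unit.
apply/eqP/eqP => [|fA].
  rewrite mulmxA scalemxAl -AJA -[RHS]mulmxA.
  by move/(can_inj (mulKmx uAJ))/(congr1 trmx); rewrite trmx_mul !trmxK.
by rewrite scalemxAl -AJA -mulmxA -trmx_mul fA mulmxA.
Qed.

Lemma card_simil1 n lam : lam != 0 ->
  #|[set A | simil (Jmx (1 + n) *m (f1 n)^T) A lam]| =
  (#|F| ^ (n + n).+1 *
    \prod_(i < n) ((#|F| ^ (n + n - 2 * i) - 1) * #|F| ^ (n + n - 2 * i - 1)))%N.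
Proof.
move=> lam0; pose N := ((1 + n) + (1 + n))%N.
(* The first pair (e, f) occupies the top rows of the two halves of A, so [f1 n *m A] is f. *)
pose g (x : ('rV[F]_N * 'rV[F]_N) * ('M[F]_(n, N) * 'M[F]_(n, N))) : 'M[F]_N :=
  col_mx (col_mx x.1.1 x.2.1) (col_mx x.1.2 x.2.2).
have bij_g : bijective g.
  exists (fun A => ((usubmx (usubmx A), usubmx (dsubmx A)),
                    (dsubmx (usubmx A), dsubmx (dsubmx A)))).
    by case=> [[e f] [E K]]; rewrite /g /= !(col_mxKu, col_mxKd).
  by move=> A; rewrite /g /= !vsubmxK.
rewrite -(on_card_preimset (onW_bij _ bij_g)).
pose J := Jmx (1 + n).
pose P := fun x : 'rV[F]_N * 'rV[F]_N =>
  (x.1 *m J *m x.2^T == lam%:M) && (x.2 == f1 n).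
pose Q (x : 'rV[F]_N * 'rV[F]_N) y := y \in hypset J lam (col_mx x.1 x.2) n.
transitivity #|[set x | P x.1 && Q x.1 x.2]|.
  apply: eq_card => -[[e f] [E K]]; rewrite /P /Q /hypset !inE simil_f1 //=.
  rewrite /f1 /g /= !mul_row_col mul0mx mul1mx mul0mx addr0 add0r.
  rewrite scale_block_mx !scaler0 scalerN scalemx1 tr_col_mx mul_col_mx mul_col_row.
  rewrite andbAC; congr (_ && _).
  transitivity (hyperbolic J lam (col_mx e E) (col_mx f K)).
    apply/eqP/and3P => [/eq_block_mx[EE EK _ KK]|[/eqP EE /eqP KK /eqP EK]].
      by split; apply/eqP.
    by rewrite EE EK KK (@form_tr _ _ _ (Jmx_tr _)) EK tr_scalar_mx.
  rewrite (@hyperbolic_col _ _ _ (@Jmx_tr _) (@Jmx_alt _)).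
  rewrite !(@col_orth _ _ _ (@Jmx_tr _)).
  by rewrite -!andbA; do !bool_congr.
rewrite (card_pair_fiber (P := P) (Q := Q)
  (k := (\prod_(i < n) ((#|F| ^ (n + n - 2 * i) - 1) *
                          #|F| ^ (n + n - 2 * i - 1)))%N)).
  congr (_ * _)%N.
  rewrite -[(n + n).+1]/(1 + (n + n))%N.
  have free_f1 : row_free (f1 n).
    apply/row_freeP; exists (f1 n)^T.
    by rewrite /f1 !tr_row_mx !mul_row_col !trmx1 !trmx0 !mulmx1 !mulmx0 add0r addr0.
  have full_f1 := row_full_form (@Jmx_unit _) free_f1.
  have -> : (1 + (n + n) = N - 1)%N by rewrite /N; lia.
  rewrite -(card_mulmx_fiber lam%:M full_f1).
  have inj_pair : injective (fun e : 'rV[F]_N => (e, f1 n)) by move=> e e' [].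
  rewrite -(card_imset _ inj_pair); apply: eq_card => -[e f]; rewrite inE /P /=.
  apply/andP/imsetP => [[ef /eqP def_f]|[e']].
    by exists e; rewrite ?inE ?mulmxA -?def_f.
  by rewrite inE mulmxA => ef [-> ->].
move=> [e f] /andP[/= /eqP ef /eqP def_f].
rewrite /Q /= cardsE (@card_hypset _ _ _ (@Jmx_unit _) (@Jmx_tr _) (@Jmx_alt _)) //.
  by apply: eq_bigr => i _; rewrite /N; congr ((_ ^ _ - _) * _ ^ _)%N; lia.
exact: (unitmx_hyp_pair (@Jmx_tr _) (@Jmx_alt _) lam0 ef).
Qed.

End Similitudes.

(** * Endomorphisms of a vector space sorted by their image *)

Section LinearCombination.
Variables (F : fieldType) (vT : vectType F) (k : nat) (b : k.-tuple vT).

Definition vcomb (v : 'rV[F]_k) : vT := \sum_i v 0 i *: b`_i.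

Fact vcomb_is_linear : linear vcomb.
Proof.
move=> a u v; rewrite /vcomb scaler_sumr -big_split; apply: eq_bigr => i _.
by rewrite !mxE scalerDl scalerA.
Qed.

HB.instance Definition _ :=
  GRing.isLinear.Build F 'rV[F]_k vT *:%R vcomb vcomb_is_linear.

End LinearCombination.

Lemma vspace_param (F : fieldType) (vT : vectType F) (W : {vspace vT}) :
  {h : 'Hom('rV[F]_(\dim W), vT) | lker h == 0%VS & limg h = W}.
Proof.
exists (linfun (vcomb (vbasis W))).
  apply/eqP/vspaceP => v; rewrite memv_ker memv0 lfunE /=.
  apply/eqP/eqP => [v0|->]; last exact: linear0.
  apply/rowP => i; rewrite mxE.
  exact: (freeP (basis_free (vbasisP W)) _ v0 i).
apply/vspaceP => v; apply/memv_imgP/idP => [[u _ ->]|Wv].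
  by rewrite lfunE /=; apply: memv_suml => i _;
    rewrite memvZ // vbasis_mem ?mem_nth ?size_tuple.
exists (\row_i coord (vbasis W) i v); first exact: memvf.
rewrite lfunE /= [LHS](coord_vbasis Wv); apply: eq_bigr => i _; by rewrite mxE.
Qed.

Section CountByImage.
Variables (F : finFieldType) (vT : vectType F).

Definition nsurj k := #|[set f : 'Hom(vT, 'rV[F]_k) | limg f == fullv]|.

(** Composition with an isomorphism from F^(dim W) to W turns surjections onto F^(dim W) into
    endomorphisms with image W. *)
Lemma card_limg_eq (W : {vspace vT}) :
  #|[set A : 'End(vT) | limg A == W]| = nsurj (\dim W).
Proof.
have [h h0 hW] := vspace_param W.
have hK : (h^-1 \o h = \1)%VF by apply: lker0_compVf.
have inj_h : injective (comp_lfun h : 'Hom(vT, 'rV[F]_(\dim W)) -> _).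
  by move=> f g /(congr1 (comp_lfun h^-1)); rewrite !comp_lfunA hK !comp_lfun1l.
rewrite /nsurj -(card_imset _ inj_h); apply: eq_card => A; rewrite inE.
apply/eqP/imsetP => [AW|[g]].
  exists (h^-1 \o A)%VF; last first.
    apply/lfunP => x; rewrite !comp_lfunE limg_lfunVK //.
    by rewrite hW -AW memv_img ?memvf.
  rewrite inE limg_comp AW; apply/eqP.
  transitivity (h^-1 @: limg h)%VS; first by rewrite hW.
  by rewrite -limg_comp hK lim1g.
by rewrite inE => /eqP gf ->; rewrite limg_comp gf.
Qed.

Lemma card_limg_pred (P : pred {vspace vT}) n :
  (forall W, P W -> (\dim W <= n)%N) ->
  #|[set A : 'End(vT) | P (limg A)]| =
  (\sum_(0 <= k < n.+1) #|[set W | (\dim W == k) && P W]| * nsurj k)%N.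
Proof.
move=> Pn.
rewrite -sum1_card (eq_bigl (fun A => P (limg A))) => [|A]; last by rewrite inE.
rewrite (partition_big (fun A : 'End(vT) => limg A) P) //=.
transitivity (\sum_(W | P W) nsurj (\dim W))%N.
  apply: eq_bigr => W PW; rewrite -card_limg_eq -sum1_card; apply: eq_bigl => A.
  by rewrite inE andbC; case: eqP => //= ->.
(* The bound on dimensions keeps [inord] from truncating. *)
rewrite (partition_big (fun W : {vspace vT} => inord (\dim W) : 'I_n.+1) predT) //=.
rewrite big_mkord; apply: eq_bigr => k _.
rewrite cardsE -sum_nat_const; apply: eq_big => W.
  rewrite unfold_in /=; case PW: (P W); rewrite ?andbF ?andbT //=.
  by rewrite -(inj_eq val_inj) /= inordK // ltnS Pn.
by case/andP=> PW /eqP <-; rewrite inordK // ltnS Pn.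
Qed.

End CountByImage.

Section MatrixOfEnd.
Variables (F : finFieldType) (N : nat).

Lemma lin1_mx_bij : bijective
  (@lin1_mx F N N \o (fun f : 'End('rV[F]_N) => f : 'rV_N -> 'rV_N)).
Proof.
exists (fun A => linfun (mulmxr A)) => [f|A].
  by apply/lfunP => v; rewrite [LHS]lfunE /= mul_rV_lin1.
by apply/row_matrixP => i; rewrite !rowE /= mul_rV_lin1 [LHS]lfunE.
Qed.

End MatrixOfEnd.

Lemma mx_form_inj (F : finFieldType) m k (M M' : 'M[F]_(m, k)) :
  (forall (u : 'rV_m) (v : 'rV_k), u *m M *m v^T = u *m M' *m v^T) -> M = M'.
Proof.
move=> eqM; apply/matrixP => i j.
have /matrixP/(_ 0 0) := eqM (delta_mx 0 i) (delta_mx 0 j).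
by rewrite trmx_delta -!colE -!rowE !mxE.
Qed.

Lemma isotropic_mx (F : finFieldType) N m (J : 'M[F]_N) (B : 'M_(m, N)) :
  (forall u v : 'rV_m, u *m B *m J *m (v *m B)^T = 0) <-> B *m J *m B^T = 0.
Proof.
split=> [BB|BJB u v]; last first.
  by rewrite trmx_mul !mulmxA -(mulmxA u) -(mulmxA u) BJB mulmx0 mul0mx.
by apply: mx_form_inj => u v;
  rewrite mulmx0 mul0mx !mulmxA -mulmxA -trmx_mul BB.
Qed.

(** * Multiplier zero: isotropic images *)

Section Isotropic.
Variables (p n : nat).
Local Notation V := 'rV['F_p]_(n + n).

Lemma sympE (v w : V) : symp v w = (v *m Jmx _ n *m w^T) 0 0.
Proof.
rewrite -[in RHS](hsubmxK v) -[in RHS](hsubmxK w) row_Jmx !mxE -sumrB.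
by apply: eq_bigr => i _; rewrite !mxE.
Qed.

Lemma isotropicP (W : {vspace V}) :
  reflect {in W &, forall v w, v *m Jmx _ n *m w^T = 0} (isotropic W).
Proof.
apply: (iffP forallP) => [isoW v w Wv Ww|isoW v].
  rewrite [LHS]mx11_scalar -sympE.
  by have /forallP/(_ w) := isoW v; rewrite Wv Ww => /eqP ->; rewrite raddf0.
apply/forallP => w; apply/implyP => Wv; apply/implyP => Ww.
by rewrite sympE isoW // mxE.
Qed.

(** For a basis matrix B of W, B J B^T = 0 bounds rank B + rank (J B^T) by 2n, and both ranks equal
    dim W. *)
Lemma dim_isotropic (W : {vspace V}) : isotropic W -> (\dim W <= n)%N.
Proof.
move/isotropicP => isoW; have [h h0 hW] := vspace_param W.
pose B := lin1_mx h.
have freeB : row_free B.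
  apply/inj_row_free => v; rewrite mul_rV_lin1 => hv.
  by apply: (lker0P h0); rewrite hv linear0.
have BJB : B *m (Jmx _ n *m B^T) = 0.
  rewrite mulmxA; apply/isotropic_mx => u v; apply: isoW;
    by rewrite mul_rV_lin1; have := memv_img h (memvf _); rewrite hW; apply.
have := mulmx0_rank_max BJB.
rewrite -[X in (_ + X)%N]mxrank_tr trmx_mul trmxK mxrankMfree; last first.
  by rewrite row_free_unit unitmx_tr Jmx_unit.
rewrite (eqP freeB); lia.
Qed.

End Isotropic.

Section Count.
Variables (p n : nat) (l : 'cV['F_p]_(n + n)).
Local Notation V := 'rV['F_p]_(n + n).

Definition form_kernel (W : {vspace V}) : bool :=
  [forall v, (v \in W) ==> (v *m l == 0)].

(** With lam = 0 the two conditions read A J A^T = 0 and A l = 0: the image is isotropic and lies in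
    the kernel of l. *)
Lemma card_simil_degenerate :
  #|[set A | simil l A 0]| = (\sum_(0 <= k < n.+1)
    #|[set W : {vspace V} | [&& \dim W == k, isotropic W & form_kernel W]]|
    * gamma p n k)%N.
Proof.
rewrite -(card_limg_pred (P := fun W => isotropic W && form_kernel W));
  last first.
  by move=> W /andP[/dim_isotropic].
rewrite -(on_card_preimset (onW_bij _ (lin1_mx_bij _ _))).
apply: eq_card => f; rewrite !inE /simil !scale0r /=; congr (_ && _).
  apply/eqP/isotropicP => [/isotropic_mx fJf v w|isoW].
    by move=> /memv_imgP[u _ ->] /memv_imgP[u' _ ->]; rewrite -!mul_rV_lin1 fJf.
  by apply/isotropic_mx => u v; rewrite !mul_rV_lin1 isoW ?memv_img ?memvf.
apply/eqP/forallP => [fl v|fl].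
  by apply/implyP => /memv_imgP[u _ ->]; rewrite -mul_rV_lin1 -mulmxA fl mulmx0.
apply/row_matrixP => i; rewrite row_mul row0 rowE mul_rV_lin1; apply/eqP.
by apply: (implyP (fl _)); rewrite memv_img ?memvf.
Qed.
End Count.

Lemma form_kernel0 p n (W : {vspace 'rV['F_p]_(n + n)}) : form_kernel 0 W.
Proof. by apply/forallP => v; rewrite mulmx0 eqxx implybT. Qed.

Lemma mul_Jmx_f1 (F : finFieldType) n (v : 'rV[F]_(1 + n + (1 + n))) :
  v *m (Jmx F (1 + n) *m (f1 F n)^T) = (v 0 (lshift _ (lshift _ 0)))%:M.
Proof.
rewrite -{1}[v]hsubmxK -{1}[lsubmx v]hsubmxK mulmxA row_Jmx !tr_row_mx !mul_row_col.
rewrite !trmx0 trmx1 !mulmx0 !addr0 subr0 mulmx1.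
by rewrite [LHS]mx11_scalar !mxE.
Qed.

Lemma form_kernel_V1 p n (W : {vspace 'rV['F_p]_(1 + n + (1 + n))}) :
  form_kernel (Jmx _ (1 + n) *m (f1 _ n)^T) W = (W <= V1 p (1 + n))%VS.
Proof.
have V1E v : (v \in V1 p (1 + n)) = (v *m (Jmx _ (1 + n) *m (f1 _ n)^T) == 0).
  rewrite mul_Jmx_f1; set i0 := lshift _ _.
  have -> : ((v 0 i0)%:M == 0 :> 'M_1) = (v 0 i0 == 0).
    apply/eqP/eqP => [/matrixP/(_ 0 0)|->]; last exact: raddf0.
    by rewrite !mxE eqxx mulr1n.
  apply/idP/eqP => [/memv_sumP[vs vsV ->]|v0].
    rewrite summxE big1 // => j j0; have /vlineP[c ->] := vsV j j0.
    rewrite !mxE /=; case: eqP => [i0j|]; last by rewrite mulr0.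
    by rewrite -i0j in j0.
  rewrite [v]row_sum_delta; apply: memv_suml => j _.
  have [|] := ltnP 0 j; last first.
    rewrite leqn0 => /eqP j0; have -> : j = i0 by apply/val_inj.
    by rewrite v0 scale0r mem0v.
  by move=> j0; apply/memvZ/(subvP (sumv_sup j j0 (subvv _)))/memv_line.
apply/forallP/subvP => WV v; first by move=> Wv; rewrite V1E (implyP (WV v)).
by apply/implyP => /WV; rewrite V1E.
Qed.

(** * Endomorphisms of a central extension of V by F_p *)

Lemma Fp_scalable p (U V : lmodType 'F_p) (g : U -> V) :
  {morph g : x y / x + y} -> scalable g.
Proof.
move=> gD a u.
have g0 : g 0 = 0 by apply: (addrI (g 0)); rewrite -gD !addr0.
have gMn m : g (u *+ m) = g u *+ m.
  by elim: m => [|m IHm]; rewrite ?mulr0n // !mulrS gD IHm.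
by rewrite -[a]natr_Zp !scaler_nat gMn.
Qed.

Lemma Fp_additive_mx p N M (g : 'rV['F_p]_N -> 'rV['F_p]_M) :
  {morph g : x y / x + y} -> exists A, forall v, g v = v *m A.
Proof.
move=> gD; exists (\matrix_i g (delta_mx 0 i)) => v.
have g0 : g 0 = 0 by apply: (addrI (g 0)); rewrite -gD !addr0.
rewrite {1}[v]row_sum_delta mulmx_sum_row (big_morph g gD g0).
by apply: eq_bigr => i _; rewrite (Fp_scalable gD) rowK.
Qed.

Section Extension.
Variables (p n : nat) (gT : finGroupType).
Local Notation V := 'rV['F_p]_(n + n).
Local Notation J := (Jmx 'F_p n).
Variables (pi : gT -> V) (s : V -> gT) (iota : 'F_p -> gT)
  (l : 'cV['F_p]_(n + n)).
Hypotheses (p_pr : prime p) (n_gt0 : (0 < n)%N).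
Hypotheses (piM : forall x y, pi (x * y)%g = pi x + pi y) (sK : cancel s pi).
Hypotheses (iotaD : forall a b, iota (a + b) = (iota a * iota b)%g)
  (iota_inj : injective iota) (pi_iota : forall c, pi (iota c) = 0)
  (pi_ker : forall x, pi x = 0 -> exists c, x = iota c).
Hypothesis commE : forall x y,
  (x * y)%g = (y * x * iota ((pi x *m J *m (pi y)^T) 0 0))%g.
Hypothesis powE : forall x, (x ^+ p)%g = iota ((pi x *m l) 0 0).

Definition lifts (x : 'M['F_p]_(n + n) * 'F_p) (f : {ffun gT -> gT}) : bool :=
  [forall y, pi (f y) == pi y *m x.1] &&
  [forall c, f (iota c) == iota (x.2 * c)].

Hypothesis lift_ex : forall x, simil l x.1 x.2 ->
  exists2 f, f \in Endg gT & lifts x f.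

Lemma EndgP (f : {ffun gT -> gT}) :
  reflect (forall x y, f (x * y)%g = (f x * f y)%g) (f \in Endg gT).
Proof.
rewrite inE; apply: (iffP forallP) => [fM x y|fM x].
  by have /forallP/(_ y)/eqP := fM x.
by apply/forallP => y; rewrite fM.
Qed.

Lemma liftsP x (f : {ffun gT -> gT}) :
  reflect ((forall y, pi (f y) = pi y *m x.1) /\
           (forall c, f (iota c) = iota (x.2 * c)))
    (lifts x f).
Proof.
apply: (iffP andP) => -[pf fi]; split; try by apply/forallP => y; apply/eqP.
  by move=> y; apply/eqP/(forallP pf).
by move=> c; apply/eqP/(forallP fi).
Qed.

Lemma iota0 : iota 0 = 1%g.
Proof. by apply: (mulgI (iota 0)); rewrite -iotaD addr0 mulg1. Qed.

Lemma iotaC a x : (iota a * x = x * iota a)%g.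
Proof. by rewrite commE pi_iota !mul0mx mxE iota0 mulg1. Qed.

Lemma pi_one : pi 1%g = 0.
Proof. by rewrite -iota0 pi_iota. Qed.

Lemma piV x : pi x^-1%g = - pi x.
Proof. by apply/eqP; rewrite -addr_eq0 -piM mulVg pi_one. Qed.

Lemma pi_eq x y : pi x = pi y -> exists c, x = (y * iota c)%g.
Proof.
move=> xy; have [|c yx] := @pi_ker (y^-1 * x)%g;
  first by rewrite piM piV xy addNr.
by exists c; rewrite -yx mulKVg.
Qed.

Lemma lifts_inj x y (f : {ffun gT -> gT}) : lifts x f -> lifts y f -> x = y.
Proof.
case: x y => [A a] [B b] /liftsP[/= pA fa] /liftsP[/= pB fb]; congr (_, _).
  apply/row_matrixP => i; rewrite !rowE -[delta_mx _ _]sK.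
  by rewrite -pA -pB.
by apply/iota_inj; rewrite -[a]mulr1 -[b]mulr1 -fa -fb.
Qed.

Lemma Endg_lifts f : f \in Endg gT -> exists2 x, simil l x.1 x.2 & lifts x f.
Proof.
move=> /EndgP fM.
have f1 : f 1%g = 1%g by apply: (mulgI (f 1%g)); rewrite -fM !mulg1.
(* [iota c] is the commutator of lifts of c e_1 and f_1 (an index exists by [n_gt0]), and
   commutators die in the abelian group V. *)
have pfi c : pi (f (iota c)) = 0.
  pose i0 := Ordinal n_gt0.
  pose x := s (row_mx (c *: delta_mx 0 i0) 0);
    pose y := s (row_mx 0 (delta_mx 0 i0)).
  have := commE x y; rewrite !sK row_Jmx mul0mx subr0 -scalemxAl trmx_delta.
  rewrite mul_delta_mx mxE mxE eqxx mulr1 => /(congr1 (pi \o f)) /=.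
  by rewrite !fM !piM [X in X = _]addrC -[X in X = _]addr0 => /addrI/esym.
have pf_eq x y : pi x = pi y -> pi (f x) = pi (f y).
  by case/pi_eq => c ->; rewrite fM piM pfi addr0.
have [|A pfA] := @Fp_additive_mx p (n + n) (n + n) (fun v => pi (f (s v))).
  by move=> u v /=; rewrite -piM -fM; apply: pf_eq; rewrite piM !sK.
have pf x : pi (f x) = pi x *m A by rewrite -pfA; apply: pf_eq; rewrite sK.
have [lam fi] : exists lam, forall c, f (iota c) = iota (lam * c).
  (* The default 0 is never taken: [pi_ker] supplies d. *)
  pose h c : ('F_p)^o := odflt 0 [pick d | f (iota c) == iota d].
  have hE c : f (iota c) = iota (h c).
    rewrite /h; case: pickP => [d /eqP //|nod].
    by have [d fd] := pi_ker (pfi c); have := nod d; rewrite fd eqxx.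
  have hD : {morph (h : ('F_p)^o -> ('F_p)^o) : a b / a + b}.
    by move=> a b; apply: iota_inj; rewrite -hE !iotaD fM !hE.
  exists (h 1) => c; rewrite hE; congr iota.
  have hZ : h (c * 1) = c * h 1 := Fp_scalable hD c 1.
  by rewrite mulrC -hZ mulr1.
exists (A, lam); last by apply/liftsP.
apply/andP; split; apply/eqP => /=.
  (* Applying f to the commutator formula yields the condition on J; below, p-th powers yield the
     one on l. *)
  apply: mx_form_inj => u v; rewrite -scalemxAr -scalemxAl.
  have := congr1 f (commE (s u) (s v)).
  rewrite !fM commE => /mulgI; rewrite !pf !sK fi => /iota_inj e.
  by apply/matrixP => i j; rewrite !ord1 [RHS]mxE -e trmx_mul !mulmxA.
apply/row_matrixP => i; rewrite !rowE mulmxA -scalemxAr -[delta_mx _ _]sK.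
set x := s _.
have : f (x ^+ p)%g = (f x ^+ p)%g.
  by elim: (p) => [|m IHm]; rewrite ?expg0 ?f1 // !expgS fM IHm.
rewrite !powE fi pf => /iota_inj e.
by apply/matrixP => ? j; rewrite !ord1 [RHS]mxE e.
Qed.

(** Two lifts differ by a homomorphism to F_p that vanishes on the centre, that is, by a linear form
    on V. *)
Lemma card_lifts x : simil l x.1 x.2 ->
  #|[set f | (f \in Endg gT) && lifts x f]| = (p ^ (n + n))%N.
Proof.
case/lift_ex=> f0 /EndgP f0M /liftsP[pf0 f0i].
pose twist (c : V) :=
  [ffun y => (f0 y * iota ((pi y *m c^T) 0 0))%g] : {ffun gT -> gT}.
have twist_inj : injective twist.
  move=> c d /ffunP cd; apply/trmx_inj/row_matrixP => i.
  have := cd (s (delta_mx 0 i)); rewrite !ffunE sK => /mulgI/iota_inj.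
  by rewrite !rowE [X in _ -> X = _]mx11_scalar => ->; rewrite -mx11_scalar.
transitivity #|[set: V]|; last by rewrite cardsT card_mx mul1n card_Fp.
rewrite -(card_imset _ twist_inj); apply: eq_card => f; rewrite inE.
apply/andP/imsetP => [[/EndgP fM /liftsP[pf fi]]|[c _ ->]]; last first.
  split.
    apply/EndgP => y z; rewrite !ffunE f0M piM mulmxDl mxE iotaD !mulgA.
    by congr (_ * _)%g; rewrite -!mulgA iotaC.
  apply/liftsP; split=> [y|d]; rewrite ffunE ?piM ?pi_iota ?addr0 //.
  by rewrite mul0mx mxE iota0 mulg1.
pose h y := odflt 0 [pick d | f y == f0 y * iota d]%g.
have hE y : f y = (f0 y * iota (h y))%g.
  rewrite /h; case: pickP => [d /eqP //|nod].
  have [|d fd] := @pi_eq (f y) (f0 y); first by rewrite pf pf0.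
  by have := nod d; rewrite fd eqxx.
have hM y z : h (y * z)%g = h y + h z.
  apply/iota_inj/(mulgI (f0 (y * z)%g)); rewrite -hE fM !hE f0M iotaD -!mulgA.
  by congr (_ * _)%g; rewrite !mulgA iotaC.
have hi c : h (iota c) = 0.
  by apply/iota_inj/(mulgI (f0 (iota c))); rewrite -hE iota0 mulg1 fi f0i.
have [|c hc] := @Fp_additive_mx p (n + n) 1 (fun v => (h (s v))%:M).
  move=> u v /=; rewrite -raddfD -hM; congr (_%:M).
  have [|d ->] := @pi_eq (s (u + v)) (s u * s v)%g; first by rewrite piM !sK.
  by rewrite [h (_ * iota d)%g]hM hi addr0.
exists c^T => //; apply/ffunP => y; rewrite ffunE hE; congr (_ * iota _)%g.
rewrite trmxK -hc [RHS]mxE eqxx mulr1n.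
have [|d {1}->] := @pi_eq y (s (pi y)); first by rewrite sK.
by rewrite hM hi addr0.
Qed.

Lemma card_Endg :
  #|Endg gT| = (p ^ (n + n) * #|[set x | simil l x.1 x.2]|)%N.
Proof.
rewrite mulnC -(card_pair_fiber (P := fun x => simil l x.1 x.2)
  (Q := fun x f => (f \in Endg gT) && lifts x f) card_lifts).
set X := [set x | _].
have inj_snd : {in X &,
    injective (@snd ('M['F_p]_(n + n) * 'F_p) {ffun gT -> gT})}.
  move=> [x f] [y g]; rewrite !inE /= => /and3P[_ _ xf] /and3P[_ _ yg] fg.
  by rewrite -fg in yg *; rewrite (lifts_inj xf yg).
rewrite -(card_in_imset inj_snd); apply: eq_card => f.
apply/idP/imsetP => [fE|[[x g]]].
  have [x Sx xf] := Endg_lifts fE; exists (x, f) => //.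
  by rewrite inE Sx fE.
by rewrite inE => /and3P[_ gE _] ->.
Qed.

End Extension.

(** * The common cocycle and its coboundaries *)

Section Cocycle.
Variables (F : finFieldType) (n : nat).
Implicit Types v w : 'rV[F]_(n + n).

(** The cocycle of both group laws; for ES2 its first summand absorbs the twist [i21 b2 * a1] (see
    [mk2M]). *)
Definition cocycle v w : F := dot (lsubmx v) (rsubmx w).

Lemma cocycleDl v1 v2 w : cocycle (v1 + v2) w = cocycle v1 w + cocycle v2 w.
Proof. by rewrite /cocycle raddfD dotDl. Qed.

Lemma cocycleDr v w1 w2 : cocycle v (w1 + w2) = cocycle v w1 + cocycle v w2.
Proof. by rewrite /cocycle raddfD dotDr. Qed.

Lemma cocycle0l w : cocycle 0 w = 0.
Proof. by rewrite /cocycle raddf0 dot0l. Qed.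

Lemma cocycle0r v : cocycle v 0 = 0.
Proof. by apply: (addrI (cocycle v 0)); rewrite -cocycleDr !addr0. Qed.

Lemma cocycle_Jmx v w : (v *m Jmx F n *m w^T) 0 0 = cocycle v w - cocycle w v.
Proof.
rewrite -{1}[v]hsubmxK -{1}[w]hsubmxK row_Jmx !mxE /cocycle /dot.
by congr (_ - _); apply: eq_bigr => i _; rewrite !mxE // mulrC.
Qed.

(* The pulled back cocycle differs from [lam] times the cocycle by a         *)
(* symmetric bilinear form, the coboundary of half its quadratic form.       *)
Lemma cocycle_coboundary (A : 'M_(n + n)) lam : (2%:R : F) != 0 ->
  A *m Jmx F n *m A^T = lam *: Jmx F n ->
  exists2 q : 'rV_(n + n) -> F, q 0 = 0 & forall v w,
    q (v + w) = q v + q w + (cocycle (v *m A) (w *m A) - lam * cocycle v w).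
Proof.
move=> F2 AJA.
pose C v w := cocycle (v *m A) (w *m A) - lam * cocycle v w.
have C_sym v w : C w v = C v w.
  have : ((v *m A) *m Jmx F n *m (w *m A)^T) 0 0 =
      lam * (v *m Jmx F n *m w^T) 0 0.
    have -> : (v *m A) *m Jmx F n *m (w *m A)^T =
        v *m (A *m Jmx F n *m A^T) *m w^T.
      by rewrite trmx_mul !mulmxA.
    by rewrite AJA -scalemxAr -scalemxAl mxE.
  rewrite !cocycle_Jmx /C => /eqP; rewrite subr_eq => /eqP ->; ring.
exists (fun v => C v v / 2%:R).
  by rewrite /C mul0mx !cocycle0l mulr0 subr0 mul0r.
move=> v w; rewrite -/(C v w).
have -> : C (v + w) (v + w) = C v v + C w w + (C v w + C w v).
  by rewrite /C !mulmxDl !cocycleDl !cocycleDr; ring.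
rewrite C_sym; move: (C v v) (C w w) (C v w) => a b c; field.
exact: F2.
Qed.

End Cocycle.

(** * Splitting by the multiplier, and arithmetic modulo p *)

Lemma card_simil p n (l : 'cV['F_p]_(n + n)) K : prime p ->
  (forall lam, lam != 0 -> #|[set A | simil l A lam]| = K) ->
  #|[set x : 'M_(n + n) * 'F_p | simil l x.1 x.2]| =
  ((p - 1) * K + #|[set A | simil l A 0]|)%N.
Proof.
move=> p_pr cardK.
transitivity (\sum_(A | true) \sum_(lam | simil l A lam) 1)%N.
  by rewrite pair_big_dep sum1dep_card.
rewrite (exchange_big_dep predT) //= (bigD1 0) //= addnC sum1dep_card.
congr (_ + _)%N; rewrite (eq_bigr (fun=> K)) => [|lam lam0].
  rewrite sum_nat_const; congr (_ * _)%N.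
  by rewrite -[in RHS](card_Fp p_pr) [in RHS](cardD1 0) inE addKn;
    apply: eq_card => x; rewrite !inE andbT.
by rewrite sum1dep_card cardK.
Qed.

Lemma mulrnFp p n (M : lmodType 'F_p) (x : M) :
  prime p -> (p %| n)%N -> x *+ n = 0.
Proof.
move=> p_pr /dvdnP[k ->]; rewrite -scaler_nat natrM.
by have /andP[_ /eqP ->] := pchar_Fp p_pr; rewrite mulr0 scale0r.
Qed.

(** Makes the cocycle term of a p-th power vanish ([mk1X], [mk2X]), so that p-th powers are linear
    on V. *)
Lemma odd_prime_bin2 p : prime p -> odd p -> (p %| 'C(p, 2))%N.
Proof. by move=> p_pr p_odd; rewrite prime_dvd_bin // odd_prime_gt2. Qed.

Lemma Fp_two_neq0 p : prime p -> odd p -> (2%:R : 'F_p) != 0.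
Proof.
move=> p_pr p_odd; apply/eqP => /(congr1 (@nat_of_ord _)).
by rewrite (val_Fp_nat p_pr) modn_small ?odd_prime_gt2.
Qed.

(** * ES1 as an extension of exponent p *)

Section CardES1.
Variables (p n : nat).
Hypotheses (p_pr : prime p) (p_odd : odd p) (n_gt0 : (0 < n)%N).

Local Notation G := (ES1 p n).

Definition pi1 (x : G) : 'rV['F_p]_(n + n) := row_mx x.1.1 x.1.2.
Definition iota1 (c : 'F_p) : G := (0, 0, c).
Definition mk1 (v : 'rV['F_p]_(n + n)) (z : 'F_p) : G := (lsubmx v, rsubmx v, z).

Lemma mk1E x : x = mk1 (pi1 x) x.2.
Proof. by case: x => [[u w] z]; rewrite /mk1 /pi1 row_mxKl row_mxKr. Qed.

Lemma pi1_mk v z : pi1 (mk1 v z) = v.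
Proof. by rewrite /pi1 hsubmxK. Qed.

Lemma mk1M v z w t : (mk1 v z * mk1 w t)%g = mk1 (v + w) (z + t + cocycle v w).
Proof. by rewrite /mk1 !raddfD. Qed.

Lemma iota1E c : iota1 c = mk1 0 c.
Proof. by rewrite /mk1 !raddf0. Qed.

Lemma mk1X v z m :
  (mk1 v z ^+ m)%g = mk1 (v *+ m) (z *+ m + cocycle v v *+ 'C(m, 2)).
Proof.
have cMn k : cocycle v (v *+ k) = cocycle v v *+ k.
  by elim: k => [|k IHk]; rewrite ?mulr0n ?cocycle0r // !mulrS cocycleDr IHk.
elim: m => [|m IHm]; first by rewrite expg0 !mulr0n addr0 -iota1E.
rewrite expgS IHm mk1M cMn !mulrS binS bin1 mulrnDr; congr mk1; ring.
Qed.

Lemma card_Endg_ES1 : #|Endg G| =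
  (p ^ (n + n) * #|[set x : 'M_(n + n) * 'F_p | simil 0 x.1 x.2]|)%N.
Proof.
apply: (@card_Endg p n _ pi1 (mk1^~ 0) iota1) => //.
- by move=> x y; rewrite [x]mk1E [y]mk1E mk1M !pi1_mk.
- by move=> v; rewrite pi1_mk.
- by move=> a b; rewrite !iota1E mk1M cocycle0l !addr0.
- by move=> a b [].
- by move=> c; rewrite iota1E pi1_mk.
- by move=> x x0; exists x.2; rewrite iota1E -x0 -mk1E.
- move=> x y;
  rewrite cocycle_Jmx [x]mk1E [y]mk1E !pi1_mk iota1E !mk1M cocycle0r.
  by rewrite !addr0 [w in mk1 w]addrC; congr mk1; ring.
- move=> x; rewrite mulmx0 mxE [x]mk1E mk1X iota1E.
  by rewrite mulrnFp ?dvdnn // !(@mulrnFp p _ ('F_p)^o) ?odd_prime_bin2 ?dvdnn // addr0.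
move=> [A lam] /= /andP[/eqP AJA _].
have [q q0 qD] := cocycle_coboundary (Fp_two_neq0 p_pr p_odd) AJA.
(* [q] compensates the failure of A to rescale the cocycle by lam; [q 0 = 0] leaves multiplication
   by lam on the centre. *)
exists [ffun x => mk1 (pi1 x *m A) (lam * x.2 + q (pi1 x))].
  apply/EndgP => x y;
    rewrite !ffunE [x]mk1E [y]mk1E mk1M !pi1_mk mk1M mulmxDl /=.
  by rewrite qD; congr mk1; ring.
apply/liftsP; split=> [x|c]; rewrite ffunE ?pi1_mk //=.
by rewrite iota1E pi1_mk mul0mx q0 addr0 -iota1E.
Qed.

End CardES1.

(** * ES2 as an extension, through reduction from Z/p^2 to F_p *)

Section ReductionModP.
Variables (p : nat) (p_pr : prime p).

(** With [i21] this gives the exact sequence 0 -> F_p -> Z/p^2 -> F_p -> 0 ([i21_inj], [redp_i21],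
    [redp_eq0]). *)
Definition redp (a : 'Z_(p ^ 2)) : 'F_p := (a : nat)%:R.

Let p2_gt1 : (1 < p ^ 2)%N.
Proof. by rewrite (ltn_exp2l 0) ?prime_gt1. Qed.

Lemma redp_nat k : redp k%:R = k%:R.
Proof.
rewrite /redp val_Zp_nat // -[LHS](Fp_nat_mod p_pr) -[RHS](Fp_nat_mod p_pr).
by rewrite modn_dvdm ?dvdn_exp.
Qed.

Lemma redpD a b : redp (a + b) = redp a + redp b.
Proof. by rewrite -[a]natr_Zp -[b]natr_Zp -natrD !redp_nat natrD. Qed.

Lemma redpM a b : redp (a * b) = redp a * redp b.
Proof. by rewrite -[a]natr_Zp -[b]natr_Zp -natrM !redp_nat natrM. Qed.

Lemma i21_nat k : i21 (k%:R : 'F_p) = (p * k)%:R.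
Proof.
rewrite /i21 val_Fp_nat // -[RHS](Zp_nat_mod p2_gt1) -mulnn -muln_modr.
by [].
Qed.

Lemma redp_i21 (c : 'F_p) : redp (i21 c) = 0.
Proof. by rewrite redp_nat natrM pchar_Fp_0 // mul0r. Qed.

Lemma redp_eq0 a : redp a = 0 -> exists c, a = i21 c.
Proof.
move/(congr1 (@nat_of_ord _)); rewrite /redp val_Fp_nat // => /eqP /dvdnP[k ak].
by exists k%:R; rewrite i21_nat mulnC -ak natr_Zp.
Qed.

Lemma i21_inj : injective (@i21 p).
Proof.
move=> a b /(congr1 (@nat_of_ord _)); rewrite /i21 !val_Zp_nat //.
have lt c : (p * (c : 'F_p) < p ^ 2)%N.
  by rewrite -mulnn ltn_pmul2l ?prime_gt0 // -[X in (_ < X)%N](Fp_cast p_pr).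
rewrite !modn_small // => /eqP; rewrite eqn_pmul2l ?prime_gt0 // => /eqP.
exact: val_inj.
Qed.

Lemma i21M (b : 'F_p) a : i21 b * a = i21 (b * redp a).
Proof.
rewrite -[b]natr_Zp -{1}[a]natr_Zp /redp -natrM !i21_nat -natrM mulnA //.
Qed.

(** The source of the first-coordinate form in the p-th power map of ES2. *)
Lemma mulrn_p a : a *+ p = i21 (redp a).
Proof. by rewrite -{1}[a]natr_Zp -mulrnA mulnC i21_nat. Qed.

End ReductionModP.

Section CardES2.
Variables (p n : nat) (p_pr : prime p) (p_odd : odd p).

Local Notation G := (ES2 n.+1 p_pr).
Local Notation V := 'rV['F_p]_(1 + n + (1 + n)).

Definition pi2 (x : G) : V :=
  let: (a, u, b, w) := x in row_mx (row_mx (redp a)%:M u) (row_mx b%:M w).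
Definition fst2 (x : G) : 'Z_(p ^ 2) := let: (a, _, _, _) := x in a.
(* The first coordinate of [v] is dropped: it is determined by [a], and       *)
(* [mk2 v a] is the expected element only when [redp a = coord1 v].           *)
Definition mk2 (v : V) (a : 'Z_(p ^ 2)) : G :=
  (a, rsubmx (lsubmx v : 'rV_(1 + n)),
   (lsubmx (rsubmx v : 'rV_(1 + n)) : 'M_1) 0 0,
   rsubmx (rsubmx v : 'rV_(1 + n))).
Definition iota2 (c : 'F_p) : G := (i21 c, 0, 0, 0).
Definition coord1 (v : V) : 'F_p := v 0 (lshift _ (lshift _ 0)).

Lemma coord1D v w : coord1 (v + w) = coord1 v + coord1 w.
Proof. by rewrite /coord1 mxE. Qed.

Lemma coord1_pi2 x : coord1 (pi2 x) = redp (fst2 x).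
Proof.
by case: x => [[[a u] b] w]; rewrite /coord1 /pi2 !row_mxEl mxE eqxx mulr1n.
Qed.

Lemma mk2E x : x = mk2 (pi2 x) (fst2 x).
Proof.
case: x => [[[a u] b] w]; rewrite /mk2 /pi2 !(row_mxKl, row_mxKr) /=.
by rewrite mxE eqxx mulr1n.
Qed.

Lemma pi2_mk v a : redp a = coord1 v -> pi2 (mk2 v a) = v.
Proof.
move=> va; rewrite /pi2 /mk2 va -mx11_scalar hsubmxK.
have -> : (coord1 v)%:M = lsubmx (lsubmx v : 'rV_(1 + n)).
  by rewrite [RHS]mx11_scalar !mxE.
by rewrite !hsubmxK.
Qed.

Lemma mk2M v a w b : redp a = coord1 v ->
  (mk2 v a * mk2 w b)%g = mk2 (v + w) (a + b + i21 (cocycle v w)).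
Proof.
move=> va.
pose x (i : V) : 'F_p := (lsubmx (rsubmx i : 'rV_(1 + n)) : 'M_1) 0 0.
have xD : x (v + w) = x v + x w by rewrite /x !raddfD [LHS]mxE.
have -> : cocycle v w = x w * redp a
     + dot (rsubmx (lsubmx v : 'rV_(1 + n))) (rsubmx (rsubmx w : 'rV_(1 + n))).
  rewrite va /cocycle /dot big_split_ord /= big_ord1 /coord1 /x !mxE mulrC.
  by congr (_ + _); apply: eq_bigr => i _; rewrite !mxE.
by rewrite /mk2 -!/(x _) xD !raddfD i21D // -i21M // addrA.
Qed.

Lemma iota2E c : iota2 c = mk2 0 (i21 c).
Proof. by rewrite /mk2 !raddf0 mxE. Qed.

Lemma mk2X v a m : redp a = coord1 v ->
  (mk2 v a ^+ m)%g = mk2 (v *+ m) (a *+ m + i21 (cocycle v v *+ 'C(m, 2))).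
Proof.
move=> va.
have cMn k : cocycle v (v *+ k) = cocycle v v *+ k.
  by elim: k => [|k IHk]; rewrite ?mulr0n ?cocycle0r // !mulrS cocycleDr IHk.
elim: m => [|m IHm]; first by rewrite expg0 !mulr0n add0r -iota2E /iota2 i21_0.
rewrite expgS IHm mk2M // cMn !mulrS binS bin1 mulrnDr i21D //; congr mk2; ring.
Qed.

Lemma card_Endg_ES2 : #|Endg G| =
  (p ^ (n.+1 + n.+1) *
   #|[set x : 'M_(1 + n + (1 + n)) * 'F_p |
        simil (Jmx _ (1 + n) *m (f1 _ n)^T) x.1 x.2]|)%N.
Proof.
pose s v := mk2 v (coord1 v : nat)%:R.
have red_coord v : redp (coord1 v : nat)%:R = coord1 v.
  by rewrite redp_nat // natr_Zp.
have red_fst x : redp (fst2 x) = coord1 (pi2 x) by rewrite coord1_pi2.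
have red_i21 c : redp (i21 c) = coord1 0 by rewrite redp_i21 // /coord1 mxE.
have mulE x y : (x * y)%g =
    mk2 (pi2 x + pi2 y) (fst2 x + fst2 y + i21 (cocycle (pi2 x) (pi2 y))).
  by rewrite -mk2M // -!mk2E.
have red_mul x y : redp (fst2 x + fst2 y + i21 (cocycle (pi2 x) (pi2 y))) =
    coord1 (pi2 x + pi2 y).
  by rewrite !redpD // redp_i21 // addr0 coord1D !red_fst.
apply: (@card_Endg p (1 + n) _ pi2 s iota2) => //.
- by move=> x y; rewrite mulE pi2_mk.
- by move=> v; rewrite pi2_mk.
- by move=> a b; rewrite !iota2E mk2M // cocycle0l i21_0 !addr0 i21D.
- by move=> a b [] /(i21_inj p_pr).
- by move=> c; rewrite iota2E pi2_mk.
- move=> x x0; have [|c xc] := @redp_eq0 p p_pr (fst2 x).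
    by rewrite red_fst x0 /coord1 mxE.
  by exists c; rewrite [x]mk2E x0 xc iota2E.
- move=> x y;
  rewrite cocycle_Jmx [(y * x)%g]mulE iota2E mk2M // cocycle0r i21_0 mulE.
  by rewrite !addr0 [pi2 y + _]addrC i21D // i21N //; congr mk2; ring.
- move=> x;
  rewrite mul_Jmx_f1 mxE eqxx mulr1n -/(coord1 _) coord1_pi2 {1}[x]mk2E mk2X //.
  rewrite (mulrnFp _ p_pr (dvdnn p)) (@mulrnFp p _ ('F_p)^o) ?odd_prime_bin2 //.
  by rewrite i21_0 addr0 mulrn_p // iota2E.
move=> [A lam] /= /andP[/eqP AJA /eqP Al].
have [q q0 qD] := cocycle_coboundary (Fp_two_neq0 p_pr p_odd) AJA.
(* Here A l = lam l is used: the proposed Z/p^2 coordinate reduces to the first coordinate of the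
   image vector, as [mk2] requires. *)
have red_lift x : redp ((lam : nat)%:R * fst2 x + i21 (q (pi2 x))) =
    coord1 (pi2 x *m A).
  rewrite redpD // redpM // redp_i21 // addr0 redp_nat // natr_Zp red_fst.
  have := congr1 (fun M => (pi2 x *m M) 0 0) Al;
    rewrite /= (mulmxA _ A) -scalemxAr.
  by rewrite !mul_Jmx_f1 [X in _ = X]mxE ![_%:M 0 0]mxE eqxx !mulr1n => <-.
exists [ffun x => mk2 (pi2 x *m A) ((lam : nat)%:R * fst2 x + i21 (q (pi2 x)))].
  apply/EndgP => x y; rewrite !ffunE mk2M // -mulmxDl.
  rewrite mulE pi2_mk //; congr mk2; rewrite /fst2 /mk2 qD.
  rewrite i21D // i21D // i21D // i21N // mulrDr mulrDr.
  rewrite [_ * i21 _]mulrC i21M // redp_nat // natr_Zp [_ * lam]mulrC.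
  ring.
apply/liftsP; split=> [x|c]; rewrite ffunE ?pi2_mk //.
rewrite !iota2E pi2_mk // mul0mx q0 i21_0 addr0; congr mk2.
by rewrite mulrC i21M // redp_nat // natr_Zp mulrC.
Qed.
End CardES2.

(** * Closed forms and conclusion *)

(** The separate powers of q have exponents 2n - 1, 2n - 3, ..., 1, which add up to n^2. *)
Lemma symplectic_order q n :
  (\prod_(i < n) ((q ^ (n + n - 2 * i) - 1) * q ^ (n + n - 2 * i - 1)) =
   q ^ (n ^ 2) * \prod_(1 <= j < n.+1) (q ^ (2 * j) - 1))%N.
Proof.
elim: n => [|n IHn]; first by rewrite big_ord0 big_geq.
rewrite big_ord_recl big_nat_recr //= muln0 subn0.
rewrite (eq_bigr (fun i : 'I_n =>
    (q ^ (n + n - 2 * i) - 1) * q ^ (n + n - 2 * i - 1))%N).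
  rewrite IHn -[(n.+1 + n.+1)%N](_ : 2 * n.+1 = _)%N;
    last by rewrite mul2n addnn.
  have -> : (n.+1 ^ 2 = (2 * n.+1 - 1) + n ^ 2)%N by rewrite -!mulnn; lia.
  by rewrite expnD; ring.
by move=> i _; rewrite /bump leq0n; congr ((_ ^ _ - _) * _ ^ _)%N; lia.
Qed.

Theorem theorem5p3 (p n : nat) (p_pr : prime p) (p_odd : odd p)
    (n_gt0 : (0 < n)%N) :
  (#|Endg (ES1 p n)| =
     p ^ (n ^ 2 + 2 * n) * (p - 1) * \prod_(1 <= j < n.+1) (p ^ (2 * j) - 1)
     + p ^ (2 * n) * \sum_(0 <= k < n.+1) alpha p n k * gamma p n k)%N
  /\
  (#|Endg (ES2 n p_pr)| =
     p ^ (n ^ 2 + 2 * n) * (p - 1) * \prod_(1 <= j < n) (p ^ (2 * j) - 1)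
     + p ^ (2 * n) * \sum_(0 <= k < n.+1) beta p n k * gamma p n k)%N.
Proof.
split.
  rewrite card_Endg_ES1 // (card_simil p_pr (fun lam => @card_simil0 _ n lam)).
  rewrite card_simil_degenerate card_Fp // symplectic_order mulnDr.
  rewrite [(p ^ (n + n))%N](_ : _ = p ^ (2 * n))%N; last by rewrite mul2n addnn.
  congr (_ + _ * _)%N; first by rewrite expnD; ring.
  apply: eq_bigr => k _; congr (_ * _)%N; apply: eq_card => W.
  by rewrite !inE form_kernel0 andbT.
case: n n_gt0 => // n _.
rewrite card_Endg_ES2 // (card_simil p_pr (fun lam => @card_simil1 _ n lam)).
rewrite card_simil_degenerate card_Fp // symplectic_order mulnDr.
rewrite [(p ^ (n.+1 + n.+1))%N](_ : _ = p ^ (2 * n.+1))%N;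
  last by rewrite mul2n addnn.
congr (_ + _ * _)%N.
  (* The three exponents come from the lifts, the partner of f_1, and the remaining n hyperbolic
     pairs. *)
  have -> : (n.+1 ^ 2 + 2 * n.+1 = 2 * n.+1 + ((n + n).+1 + n ^ 2))%N.
    by rewrite -!mulnn; lia.
  by rewrite !expnD; ring.
apply: eq_bigr => k _; congr (_ * _)%N; apply: eq_card => W.
by rewrite !inE form_kernel_V1.
Qed.
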